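(* Let $p$ be a prime, let $k\geq 1$ be an integer, and let $a_n^{(k)}$ be the Mahler coefficients of the $k$-fold iterate $\mathcal{S}^k$ of the $p$-adic shift, i.e. $\mathcal{S}^k(x)=\sum_{n=0}^\infty a_n^{(k)}\binom{x}{n}$ for all $x\in\mathbb{Z}_p$. Then the maximum of $p^{\lfloor\log_p n\rfloor}|a_n^{(k)}|$ over integers $n\geq 1$ is $p^k$, and it is attained only at $n=p^k$.
   Context: $|\cdot|$ denotes the $p$-adic absolute value on $\mathbb{Z}_p$, with $|p|=1/p$. The $p$-adic shift $\mathcal{S}:\mathbb{Z}_p\to\mathbb{Z}_p$: if $x=\sum_{i\geq 0} b_i p^i$ with $b_i\in\{0,1,\dots,p-1\}$, then $\mathcal{S}(x)=\sum_{i\geq 0} b_{i+1}p^i$. It is continuous. Mahler expansion: every continuous $T:\mathbb{Z}_p\to\mathbb{Z}_p$ can be written uniquely as a uniformly convergent series $T(x)=\sum_{n=0}^\infty a_n\binom{x}{n}$, with $a_n=\sum_{i=0}^n(-1)^{n+i}T(i)\binom{n}{i}\in\mathbb{Z}_p$. *)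

(* Defs.v *)
From HB Require Import structures.
From mathcomp Require Import all_boot all_order all_algebra.
From mathcomp Require Import all_classical all_reals all_analysis.

Set Implicit Arguments.
Unset Strict Implicit.
Unset Printing Implicit Defensive.

Import Order.TTheory GRing.Theory Num.Theory.
Local Open Scope classical_set_scope.
Local Open Scope ring_scope.

(* Z_p as the inverse limit of the Z/p^n: an element is the sequence of its
   least nonnegative residues modulo p^n, so the condition also forces
   x n < p^n (and x 0 = 0). *)
Record padic_int (p : nat) (hp : prime p) := PadicInt {
  padic_res :> nat -> nat;
  padic_resP : forall n, padic_res n = (padic_res n.+1 %% p ^ n)%N }.

HB.instance Definition _ (p : nat) (hp : prime p) := gen_eqMixin (padic_int hp).
HB.instance Definition _ (p : nat) (hp : prime p) :=
  gen_choiceMixin (padic_int hp).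

Section PadicInt.
Variables (p : nat) (hp : prime p).
Local Notation Zp := (padic_int hp).
Implicit Types (x y z : Zp) (m n : nat).

Lemma padic_ext x y : x =1 y -> x = y.
Proof.
case: x y => [f hf] [g hg] /= /funext efg; subst g.
by congr PadicInt; apply: Prop_irrelevance.
Qed.

Let pX_gt0 n : (0 < p ^ n)%N.
Proof. by rewrite expn_gt0 prime_gt0. Qed.

Let mod_mod a n : (a %% p ^ n.+1 %% p ^ n = a %% p ^ n)%N.
Proof. by rewrite modn_dvdm// dvdn_exp2l. Qed.

Lemma padic_res_mod x m n : (m <= n)%N -> (x n %% p ^ m = x m)%N.
Proof.
elim: n => [|n IHn]; last first.
  rewrite leq_eqVlt => /predU1P[->|]; first by rewrite (padic_resP x) modn_mod.
  rewrite ltnS => mn; rewrite -(IHn mn) [in RHS]padic_resP.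
  by rewrite modn_dvdm// dvdn_exp2l.
by rewrite leqn0 => /eqP->; rewrite (padic_resP x) modn_mod.
Qed.

Lemma padic_res_lt x n : (x n < p ^ n)%N.
Proof. by rewrite padic_resP ltn_pmod. Qed.

Lemma padic_res_ord0 x : x 0%N = 0%N.
Proof. by have := padic_res_lt x 0; rewrite expn0; case: (x 0%N). Qed.

Fact padic_nat_subproof a n : (a %% p ^ n = a %% p ^ n.+1 %% p ^ n)%N.
Proof. by rewrite mod_mod. Qed.
Definition padic_nat a : Zp := PadicInt hp (padic_nat_subproof a).

Fact padic_opp_subproof x n :
  ((p ^ n - x n) %% p ^ n = (p ^ n.+1 - x n.+1) %% p ^ n.+1 %% p ^ n)%N.
Proof.
rewrite mod_mod; apply/eqP; rewrite -(eqn_modDr (x n)).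
rewrite subnK ?(ltnW (padic_res_lt _ _))// modnn.
rewrite (padic_resP x n) modnDmr subnK ?(ltnW (padic_res_lt _ _))//.
by rewrite eq_sym -/(dvdn _ _) dvdn_exp2l.
Qed.
Definition padic_opp x : Zp := PadicInt hp (padic_opp_subproof x).

Fact padic_add_subproof x y n :
  ((x n + y n) %% p ^ n = (x n.+1 + y n.+1) %% p ^ n.+1 %% p ^ n)%N.
Proof. by rewrite mod_mod (padic_resP x) (padic_resP y) modnDm. Qed.
Definition padic_add x y : Zp := PadicInt hp (padic_add_subproof x y).

Fact padic_mul_subproof x y n :
  ((x n * y n) %% p ^ n = (x n.+1 * y n.+1) %% p ^ n.+1 %% p ^ n)%N.
Proof. by rewrite mod_mod (padic_resP x) (padic_resP y) modnMm. Qed.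
Definition padic_mul x y : Zp := PadicInt hp (padic_mul_subproof x y).

Fact padic_addA : associative padic_add.
Proof. by move=> x y z; apply: padic_ext => n /=; rewrite modnDml modnDmr addnA. Qed.
Fact padic_addC : commutative padic_add.
Proof. by move=> x y; apply: padic_ext => n /=; rewrite addnC. Qed.
Fact padic_add0 : left_id (padic_nat 0) padic_add.
Proof.
by move=> x; apply: padic_ext => n /=; rewrite mod0n add0n modn_small// padic_res_lt.
Qed.
Fact padic_addN : left_inverse (padic_nat 0) padic_opp padic_add.
Proof.
move=> x; apply: padic_ext => n /=.
by rewrite modnDml subnK ?(ltnW (padic_res_lt _ _))// modnn mod0n.
Qed.
Fact padic_mulA : associative padic_mul.
Proof. by move=> x y z; apply: padic_ext => n /=; rewrite modnMml modnMmr mulnA. Qed.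
Fact padic_mulC : commutative padic_mul.
Proof. by move=> x y; apply: padic_ext => n /=; rewrite mulnC. Qed.
Fact padic_mul1 : left_id (padic_nat 1) padic_mul.
Proof.
by move=> x; apply: padic_ext => n /=; rewrite modnMml mul1n modn_small// padic_res_lt.
Qed.
Fact padic_mulDl : left_distributive padic_mul padic_add.
Proof.
by move=> x y z; apply: padic_ext => n /=; rewrite modnMml modnDm mulnDl.
Qed.
Fact padic_1neq0 : padic_nat 1 != padic_nat 0.
Proof.
apply/eqP => /(congr1 (fun x : Zp => x 1%N)) /=.
by rewrite expn1 mod0n modn_small// prime_gt1.
Qed.

HB.instance Definition _ := GRing.isZmodule.Build Zp
  padic_addA padic_addC padic_add0 padic_addN.
HB.instance Definition _ := GRing.Zmodule_isComNzRing.Build Zp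
  padic_mulA padic_mulC padic_mul1 padic_mulDl padic_1neq0.

Lemma padic_res0 n : (0 : Zp) n = 0%N.
Proof. exact: mod0n. Qed.
Lemma padic_resD x y n : (x + y) n = ((x n + y n) %% p ^ n)%N.
Proof. by []. Qed.
Lemma padic_resM x y n : (x * y) n = ((x n * y n) %% p ^ n)%N.
Proof. by []. Qed.
Lemma padic_res_nat m n : (m%:R : Zp) n = (m %% p ^ n)%N.
Proof.
elim: m => [|m IHm]; first by rewrite padic_res0 mod0n.
by rewrite -natr1 padic_resD IHm modnDm addn1.
Qed.

(* |x| = p^-v with v the largest n such that p^n divides x. *)
Definition padic_abs x : rat :=
  if pselect (exists n, x n.+1 != 0%N) is left ex then (p%:R ^- ex_minn ex)
  else 0.

Lemma padic_abs_le x n : (padic_abs x <= p%:R ^- n) = (x n == 0%N).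
Proof.
have p1 : (1 : rat) < p%:R by rewrite ltr1n prime_gt1.
have p0 : (0 : rat) < p%:R by rewrite ltr0n prime_gt0.
rewrite /padic_abs; case: pselect => [ex|nex].
  case: ex_minnP => v xv vmin.
  rewrite lef_pV2 ?posrE ?exprn_gt0// ler_eXn2l//; apply/idP/idP => [nv|/eqP xn].
    case: n nv => [|n nv]; first by rewrite padic_res_ord0.
    by apply: contraTT nv => /vmin; rewrite -ltnNge ltnS.
  rewrite leqNgt; apply: contra xv => vn.
  by rewrite -(padic_res_mod _ vn) xn mod0n.
rewrite invr_ge0 exprn_ge0 ?(ltW p0)//; apply/esym.
case: n => [|n]; first by rewrite padic_res_ord0.
by apply/negP => /negP xn; apply: nex; exists n.
Qed.

Lemma padic_abs_cases x : padic_abs x = 0 \/ exists n, padic_abs x = p%:R ^- n.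
Proof.
by rewrite /padic_abs; case: pselect => [ex|_]; [right; exists (ex_minn ex)|left].
Qed.

Lemma padic_abs_ge0 x : 0 <= padic_abs x.
Proof.
by case: (padic_abs_cases x) => [->//|[n ->]]; rewrite invr_ge0 exprn_ge0.
Qed.

Lemma padic_abs_eq0 x : padic_abs x = 0 -> x = 0.
Proof.
move=> x0; apply: padic_ext => n; rewrite padic_res0; apply/eqP.
by rewrite -padic_abs_le x0 invr_ge0 exprn_ge0.
Qed.

Lemma padic_abs0 : padic_abs 0 = 0.
Proof.
by rewrite /padic_abs; case: pselect => // ex; have [n] := ex; rewrite padic_res0.
Qed.

Lemma padic_absN x : padic_abs (- x) = padic_abs x.
Proof.
suff le y : padic_abs (- y) <= padic_abs y.
  by apply/eqP; rewrite eq_le le -{1}[x]opprK le.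
case: (padic_abs_cases y) => [y0|[n yn]].
  by rewrite y0 (padic_abs_eq0 y0) oppr0 padic_abs0.
have : padic_abs y <= p%:R ^- n by rewrite yn.
rewrite padic_abs_le => /eqP yn0; rewrite yn padic_abs_le.
by apply/eqP; rewrite [LHS]/= yn0 subn0 modnn.
Qed.

Lemma padic_absD x y :
  padic_abs (x + y) <= Num.max (padic_abs x) (padic_abs y).
Proof.
wlog xy : x y / padic_abs x <= padic_abs y => [H|].
  have [xy|/ltW yx] := leP (padic_abs x) (padic_abs y).
    by have := H _ _ xy; rewrite max_r.
  by have := H _ _ yx; rewrite addrC max_r.
rewrite max_r//; case: (padic_abs_cases y) => [y0|[n yn]].
  by rewrite (padic_abs_eq0 y0) addr0 -(padic_abs_eq0 y0).
have /eqP y0 : y n == 0%N by rewrite -padic_abs_le yn.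
move: xy; rewrite yn !padic_abs_le => /eqP x0.
by rewrite padic_resD x0 y0 mod0n.
Qed.

Definition padic_dist x y := padic_abs (x - y).

Fact padic_distxx x : padic_dist x x = 0.
Proof. by rewrite /padic_dist subrr padic_abs0. Qed.
Fact padic_dist_eq0 x y : padic_dist x y = 0 -> x = y.
Proof. by move=> /padic_abs_eq0/eqP; rewrite subr_eq0 => /eqP. Qed.
Fact padic_dist_sym x y : padic_dist x y = padic_dist y x.
Proof. by rewrite /padic_dist -padic_absN opprB. Qed.
Fact padic_dist_triangle y x z :
  padic_dist x z <= padic_dist x y + padic_dist y z.
Proof.
rewrite /padic_dist -(subrKA y); apply: (le_trans (padic_absD _ _)).
by rewrite ge_max lerDl lerDr !padic_abs_ge0.
Qed.

HB.instance Definition _ := isMetric.Build rat Zp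
  padic_distxx padic_dist_eq0 padic_dist_sym padic_dist_triangle.

Definition padic_digit x i : nat := (x i.+1 %/ p ^ i)%N.

Fact padic_of_digits_subproof (b : nat -> nat) n :
  ((\sum_(i < n) b i * p ^ i) %% p ^ n =
   (\sum_(i < n.+1) b i * p ^ i) %% p ^ n.+1 %% p ^ n)%N.
Proof. by rewrite mod_mod big_ord_recr/= -modnDmr modnMl addn0. Qed.
Definition padic_of_digits (b : nat -> nat) : Zp :=
  PadicInt hp (padic_of_digits_subproof b).

Lemma padic_digit_lt x i : (padic_digit x i < p)%N.
Proof. by rewrite ltn_divLR// -expnS padic_res_lt. Qed.

Lemma padic_digit_sum x n : (\sum_(i < n) padic_digit x i * p ^ i = x n)%N.
Proof.
elim: n => [|n IHn].
  by rewrite big_ord0 padic_res_ord0.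
by rewrite big_ord_recr/= IHn padic_resP addnC -divn_eq.
Qed.

Lemma padic_digitK x : padic_of_digits (padic_digit x) = x.
Proof.
by apply: padic_ext => n /=; rewrite padic_digit_sum modn_small// padic_res_lt.
Qed.

Lemma padic_of_digitsK (b : nat -> nat) :
  (forall i, (b i < p)%N) -> padic_digit (padic_of_digits b) =1 b.
Proof.
move=> bp i.
have lt n : (\sum_(j < n) b j * p ^ j < p ^ n)%N.
  elim: n => [|n IHn]; first by rewrite big_ord0.
  rewrite big_ord_recr/= (@leq_trans ((b n).+1 * p ^ n))//.
    by rewrite mulSn ltn_add2r.
  by rewrite expnS leq_mul2r bp orbT.
by rewrite /padic_digit/= modn_small ?lt// big_ord_recr/= addnC divnMDl// divn_small ?addn0 ?lt//.
Qed.

Lemma cvg_padic_of_digits (b : nat -> nat) :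
  series (fun i => (b i)%:R * p%:R ^+ i : Zp) @ \oo --> padic_of_digits b.
Proof.
apply/cvg_ballP => e e0.
have [N Ne] : exists N, (p%:R : rat) ^- N < e.
  have [N Ne] : exists N, e^-1 < (N%:R : rat).
    by exists (Num.bound e^-1); rewrite archi_boundP// invr_ge0 ltW.
  exists N; rewrite invf_plt ?posrE ?exprn_gt0 ?ltr0n ?prime_gt0//.
  by rewrite (lt_trans Ne)// -natrX ltr_nat ltn_expl// prime_gt1.
exists N => // n /= Nn; rewrite ballEmdist/=; apply: le_lt_trans Ne.
rewrite [leLHS]/(padic_abs _) padic_abs_le; apply/eqP.
suff -> : (padic_of_digits b - series (fun i => (b i)%:R * p%:R ^+ i) n : Zp) N
   = (0 : Zp) N by rewrite padic_res0.
set s := series _ n; have sN : padic_of_digits b N = s N.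
  have -> : s = (\sum_(i < n) b i * p ^ i)%:R.
    by rewrite /s /series/= big_mkord natr_sum; apply: eq_bigr => i _; rewrite natrM natrX.
  rewrite padic_res_nat -(padic_res_mod (padic_of_digits b) Nn)/=.
  by rewrite modn_dvdm// dvdn_exp2l.
by rewrite padic_resD sN -padic_resD subrr.
Qed.

Definition padic_shift x : Zp := padic_of_digits (fun i => padic_digit x i.+1).

(* x(x-1)...(x-n+1)/n!; the quotient exists and is unique, see below. *)
Definition padic_binom x n : Zp :=
  xget 0 [set y | y *+ n`! = \prod_(i < n) (x - i%:R)].

Let cancel_fact n m a b :
  (a * n`! = b * n`! %[mod p ^ (m + logn p n`!)] -> a = b %[mod p ^ m])%N.
Proof.
wlog ba : a b / (b <= a)%N => [H|].
  have [ba|/ltnW ab] := leqP b a; first exact: H.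
  by move=> /esym/(H _ _ ab)/esym.
move=> /eqP; rewrite eqn_mod_dvd ?leq_mul2r ?ba ?orbT// -mulnBl => d.
apply/eqP; rewrite eqn_mod_dvd//.
have [q qp En] := pfactor_coprime hp (fact_gt0 n).
move: d; rewrite {2}En expnD mulnA dvdn_pmul2r// Gauss_dvdl//.
by rewrite coprimeXl.
Qed.

Lemma padic_mulrn_factI n x y : x *+ n`! = y *+ n`! -> x = y.
Proof.
move=> exy; apply: padic_ext => m.
rewrite -(padic_res_mod x (leq_addr (logn p n`!) m)).
rewrite -(padic_res_mod y (leq_addr (logn p n`!) m)).
apply: (@cancel_fact n); move: exy; rewrite -mulr_natr -[RHS]mulr_natr.
move=> /(congr1 (fun z : Zp => z (m + logn p n`!)%N)).
by rewrite !padic_resM !padic_res_nat !modnMmr.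
Qed.

Let prod_ffact m n : \prod_(i < n) (m%:R - i%:R : Zp) = (m ^_ n)%:R.
Proof.
elim: n => [|n IHn]; first by rewrite big_ord0.
rewrite big_ord_recr/= IHn ffactnSr natrM.
have [nm|mn] := leqP n m; first by rewrite natrB.
by rewrite ffact_small// !mul0r.
Qed.

Let res_prod x n M : (\prod_(i < n) (x - i%:R)) M = (((x M) ^_ n) %% p ^ M)%N.
Proof.
rewrite -padic_res_nat -prod_ffact.
apply: (big_ind2 (fun u v : Zp => u M = v M)) => //.
  by move=> a b c d ab cd; rewrite !padic_resM ab cd.
move=> i _; have xM : ((x M)%:R : Zp) M = x M.
  by rewrite padic_res_nat modn_small// padic_res_lt.
by rewrite padic_resD [RHS]padic_resD xM.
Qed.

Fact padic_binom_subproof x n m :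
  ('C(x (m + logn p n`!), n) %% p ^ m =
   'C(x (m.+1 + logn p n`!), n) %% p ^ m.+1 %% p ^ m)%N.
Proof.
rewrite mod_mod; apply: (@cancel_fact n); rewrite !bin_ffact addSn.
by rewrite -res_prod padic_resP res_prod mod_mod.
Qed.

Lemma padic_binomE x n : padic_binom x n *+ n`! = \prod_(i < n) (x - i%:R).
Proof.
rewrite /padic_binom; case: xgetP => [y _ //|/(_ (PadicInt hp (padic_binom_subproof x n)))].
case; apply: padic_ext => m /=.
rewrite -mulr_natr padic_resM/= padic_res_nat modnMm bin_ffact.
rewrite -(padic_res_mod _ (leq_addr (logn p n`!) m)) res_prod.
by rewrite modn_dvdm// dvdn_exp2l// leq_addr.
Qed.

Lemma padic_binom_nat m n : padic_binom m%:R n = 'C(m, n)%:R.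
Proof.
apply: (@padic_mulrn_factI n); rewrite padic_binomE prod_ffact.
by rewrite -bin_ffact natrM mulr_natr.
Qed.

(* Convergence is for the metric |x - y| on Z_p, at every point x; uniformity in
   x is not required. *)
Definition mahler_expansion (T : Zp -> Zp) (a : nat -> Zp) : Prop :=
  forall x, series (fun n => a n * padic_binom x n) @ \oo --> T x.

End PadicInt.

(* Main.v *)
Require Import Defs.
From mathcomp Require Import all_boot all_order all_algebra.
From mathcomp Require Import all_classical all_reals all_analysis.
From mathcomp Require Import ring zify.

(** The first $q = p^k$ Mahler coefficients of the $k$-th iterate vanish, the
    $q$-th one is $1$, and Weisman's congruence makes every later coefficient
    too small to compete.

    On a natural number $m$ the iterate takes the value $\lfloor m/q \rfloor$,
    and the binomial series at $m$ is a finite sum, so the coefficients are the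
    only solution of the triangular system
    $\sum_{n \le m} a_n \binom{m}{n} = \lfloor m/q \rfloor$
    ([mahler_expansion_nat], [bin_sum_inj]).  Let $\phi(P)$ be the coefficient
    of $X^{q-1}$ in $P$ modulo $X^q - 1$.  Then $\phi(X^j)$ is $1$ if
    $q \mid j+1$ and $0$ otherwise, so $\phi(\sum_{j<m} X^j)$ counts the
    multiples of $q$ up to $m$.  Since
    $\sum_{j<m} X^j = \sum_{n<m} \binom{m}{n+1} (X-1)^n$, the system is solved
    by $a_0 = 0$ and $a_{n+1} = \phi((X-1)^n)$ ([sum_shift_coef]).

    For $n < q$ the polynomial $(X-1)^{n-1}$ has degree below $q-1$, hence
    $a_n = 0$; for $n = q$ it is monic of degree $q-1$, hence $a_q = 1$.  For
    $n > q$, let $Y = X^{p^{k-1}}$.  Modulo $X^q - 1 = Y^p - 1$, the power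
    $(X-1)^{p^{k-1}}$ lies in the ideal $M = (Y-1, p)$, and multiplication by
    $(X-1)^{p^{k-1}(p-1)}$ sends $M$ into $pM$.  Therefore $p^e$ divides $a_n$
    as soon as $p^{k-1} + e\,p^{k-1}(p-1) < n$ ([weisman_congruence],
    [shift_coef_dvd]).  Bernoulli's inequality shows that
    $e = \lfloor \log_p n \rfloor - k + 1$ meets this condition
    ([weisman_exponent_lt]), so that $p^{\lfloor \log_p n \rfloor} |a_n|$ is at
    most $p^{k-1}$. *)

Set Implicit Arguments.
Unset Strict Implicit.

Import Order.TTheory GRing.Theory Num.Theory.
Local Open Scope ring_scope.

(** * Powers of t - 1 modulo t ^ (p ^ k) - 1 *)

(** The mixed terms are kept divisible by both a and b: [weisman_congruence]
    uses the factor a as well as the factor p. *)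
Lemma exprD_prime (R : comNzRingType) (p : nat) (a b : R) : prime p ->
  exists h, (a + b) ^+ p = a ^+ p + b ^+ p + p%:R * (a * b * h).
Proof.
case: p => // p hp.
exists (\sum_(i < p) ('C(p.+1, i.+1) %/ p.+1)%:R * (a ^+ (p - i.+1) * b ^+ i)).
rewrite exprDn big_ord_recl big_ord_recr /=.
rewrite /bump /= !add1n subn0 subnn bin0 binn expr0 !mulr1 mul1r !mulr1n.
rewrite -addrA; congr (_ + _); rewrite addrC; congr (_ + _).
rewrite !mulr_sumr; apply: eq_bigr => i _; rewrite add1n.
have lt_ip : (i.+1 < p.+1)%N by rewrite ltnS.
have /divnK {1}<- : (p.+1 %| 'C(p.+1, i.+1))%N by rewrite prime_dvd_bin.
rewrite subSS -(subnSK (ltn_ord i)).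
by rewrite !exprS -[LHS]mulr_natr natrM; ring.
Qed.

Lemma eqmod_expr (R : comNzRingType) (c a b h : R) n :
  a = b + c * h -> exists g, a ^+ n = b ^+ n + c * g.
Proof.
move=> ->; exists (h * \sum_(i < n) (b + c * h) ^+ (n.-1 - i) * b ^+ i).
by apply/eqP; rewrite -subr_eq0 opprD addrA subr_eq0 subrXX addrC addKr mulrA.
Qed.

(** Frobenius gives this at once in characteristic p; the error term is explicit
    here because p need not vanish in R.  Expanding the p-th power of
    [(t ^ (p ^ j) - 1) + 1], rather than of a difference, avoids any
    discussion of the sign (-1) ^ p. *)
Lemma exprB1_prime_power (R : comNzRingType) (p j : nat) (t : R) : prime p ->
  exists h, (t - 1) ^+ (p ^ j) = t ^+ (p ^ j) - 1 + p%:R * h.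
Proof.
move=> hp; elim: j => [|j [h IHj]].
  by exists 0; rewrite !expr1 mulr0 addr0.
set x := t - 1 in IHj *; set Y := t ^+ (p ^ j) in IHj.
rewrite expnSr !exprM -/Y.
have EY : Y - 1 = x ^+ (p ^ j) + p%:R * - h by rewrite IHj; ring.
have [g Eg] := eqmod_expr p EY.
have [f Ef] := exprD_prime (Y - 1) 1 hp.
exists (- g - (Y - 1) * f); move: Ef; rewrite subrK => ->.
by rewrite Eg expr1n; ring.
Qed.

(** With y = t ^ (p ^ j) - 1 and z = t ^ (p ^ j.+1) - 1, the claim is that modulo
    z the power of t - 1 lies in p ^ e * M, where M is the ideal (y, p).  For
    e = 0 this is [exprB1_prime_power].  Multiplying by
    s := (t - 1) ^ (p ^ j * p.-1) gains one factor p: s = y ^ p.-1 mod p, so s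
    lies in M and s * p in p * M; moreover s * y = y ^ p mod p * y, and
    y ^ p = z mod p * y because (y + 1) ^ p = z + 1. *)
Lemma weisman_congruence (R : comNzRingType) (p j e : nat) (t : R) : prime p ->
  exists u v w, (t - 1) ^+ (p ^ j + e * (p ^ j * p.-1)) =
    p%:R ^+ e * (u * (t ^+ (p ^ j) - 1) + v * p%:R) + w * (t ^+ (p ^ j.+1) - 1).
Proof.
move=> hp; have p_gt1 := prime_gt1 hp.
have [h Eh] := exprB1_prime_power j t hp.
set y := t ^+ (p ^ j) - 1 in Eh *; set z := t ^+ (p ^ j.+1) - 1.
elim: e => [|e [u [v [w IHe]]]].
  by exists 1, h, 0; rewrite mul0n addn0 Eh; ring.
have [f Ef] : exists f, y ^+ p = z + p%:R * (y * f).
  have [f] := exprD_prime y 1 hp; rewrite subrK -exprM -expnSr expr1n => Ef.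
  by exists (- f); rewrite /z Ef; ring.
set m := (p ^ j * p.-1)%N.
have [g Eg] : exists g, (t - 1) ^+ m = y ^+ p.-1 + p%:R * g.
  by rewrite exprM; apply: eqmod_expr Eh.
have ypE : y ^+ p.-1 * y = z + p%:R * (y * f).
  by rewrite -exprSr prednK ?Ef // ltnW.
have ymE : y ^+ p.-1 = y * y ^+ p.-2 by rewrite -exprS; congr (_ ^+ _); lia.
exists (u * (f + g) + v * y ^+ p.-2), (v * g).
exists (w * (t - 1) ^+ m + p%:R ^+ e * u).
rewrite mulSnr addnA exprD IHe.
transitivity (p%:R ^+ e * (u * (y * (t - 1) ^+ m) + v * p%:R * (t - 1) ^+ m)
  + w * (t - 1) ^+ m * z); first by ring.
have -> : y * (t - 1) ^+ m = z + p%:R * (y * (f + g)) by rewrite Eg mulrDr mulrC ypE; ring.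
rewrite {1}Eg ymE [p%:R ^+ e.+1]exprSr; ring.
Qed.

(** Multiplied by t - 1, both sides become t ^ m - 1; induction with Pascal's rule
    gives the identity without cancelling t - 1, which may be a zero divisor. *)
Lemma sum_bin_geometric (R : comNzRingType) (m : nat) (t : R) :
  \sum_(n < m) 'C(m, n.+1)%:R * (t - 1) ^+ n = \sum_(j < m) t ^+ j.
Proof.
elim: m => [|m IHm]; first by rewrite !big_ord0.
rewrite [RHS]big_ord_recr /= -IHm.
under eq_bigr do rewrite binS natrD mulrDl.
rewrite big_split /= big_ord_recr /= bin_small // mul0r addr0; congr (_ + _).
rewrite -{2}[t](subrK 1) exprD1n.
by apply: eq_bigr => i _; rewrite mulr_natl.
Qed.

(** * Mahler coefficients of the quotient by q *)

Section CyclicCoef.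
Variables (R : comNzRingType) (q : nat) (q_gt0 : (0 < q)%N).
Implicit Types P Q : {poly R}.

(** A linear form on R[X] / (X ^ q - 1).  The degree q.-1 is chosen so that 'X^j
    is sent to 1 exactly when j.+1 is a multiple of q, which is when
    floor(m / q) jumps as m goes from j to j.+1. *)
Definition cyclic_coef P : R := (Pdiv.Ring.rmodp P ('X^q - 1))`_q.-1.

Let monic_q : 'X^q - 1 \is @monic R.
Proof. exact: monicXnsubC. Qed.

Let size_q : size ('X^q - 1 : {poly R}) = q.+1.
Proof. exact: size_XnsubC. Qed.

Lemma cyclic_coef_add_mull P Q : cyclic_coef (P + Q * ('X^q - 1)) = cyclic_coef P.
Proof.
by rewrite /cyclic_coef Pdiv.RingMonic.rmodpD // Pdiv.RingMonic.rmodp_mull // addr0.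
Qed.

Lemma cyclic_coef_natrM P m : cyclic_coef (m%:R * P) = m%:R * cyclic_coef P.
Proof.
by rewrite -polyC_natr mul_polyC /cyclic_coef Pdiv.RingMonic.rmodpZ // coefZ.
Qed.

Lemma cyclic_coef_sum (I : Type) (r : seq I) (F : I -> {poly R}) :
  cyclic_coef (\sum_(i <- r) F i) = \sum_(i <- r) cyclic_coef (F i).
Proof. by rewrite /cyclic_coef Pdiv.RingMonic.rmodp_sum // coef_sum. Qed.

Lemma cyclic_coef_small P : (size P <= q)%N -> cyclic_coef P = P`_q.-1.
Proof. by move=> sP; rewrite /cyclic_coef Pdiv.Ring.rmodp_small // size_q ltnS. Qed.

Lemma cyclic_coefXn j : cyclic_coef 'X^j = (q %| j.+1)%:R.
Proof.
have [Q ->] : exists Q, 'X^j = 'X^(j %% q) + Q * ('X^q - 1) :> {poly R}.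
  exists ('X^(j %% q) * \sum_(i < j %/ q) 'X^q ^+ i).
  rewrite -mulrA [X in _ * X]mulrC -subrX1 mulrBr mulr1 addrC subrK.
  by rewrite -exprM -exprD addnC mulnC -divn_eq.
rewrite cyclic_coef_add_mull cyclic_coef_small ?size_polyXn ?ltn_pmod //.
rewrite coefXn; congr (_%:R); congr nat_of_bool.
rewrite /dvdn -addn1 -modnDml addn1.
have := ltn_pmod j q_gt0; rewrite leq_eqVlt => /predU1P[E|lt].
  by rewrite E modnn eqxx -(eqn_add2r 1) !addn1 E prednK // eqxx.
by rewrite [in RHS]modn_small //=; apply: negbTE; rewrite neq_ltn -[X in _ || X]ltnS prednK // lt orbT.
Qed.

Lemma count_dvdn_succ m : (\sum_(j < m) (q %| j.+1) = m %/ q)%N.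
Proof.
by elim: m => [|m IHm]; rewrite ?big_ord0 ?div0n // big_ord_recr /= IHm divnS // addnC.
Qed.

(** The n-th finite difference at 0 of m |-> m %/ q: the first difference is the
    indicator of q %| j.+1, and n.-1 further differences amount to applying
    [cyclic_coef] to ('X - 1) ^+ n.-1. *)
Definition shift_coef n : R := if n is m.+1 then cyclic_coef (('X - 1) ^+ m) else 0.

Lemma sum_shift_coef m :
  \sum_(n < m.+1) shift_coef n * 'C(m, n)%:R = (m %/ q)%:R.
Proof.
rewrite big_ord_recl /= mul0r add0r -count_dvdn_succ natr_sum.
under [RHS]eq_bigr do rewrite -cyclic_coefXn.
rewrite -cyclic_coef_sum -sum_bin_geometric cyclic_coef_sum.
by apply: eq_bigr => i _; rewrite cyclic_coef_natrM mulrC.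
Qed.

Lemma size_XB1n m : size (('X - 1 : {poly R}) ^+ m) = m.+1.
Proof. by rewrite -polyC1 size_exp_XsubC. Qed.

Lemma shift_coef_small n : (n < q)%N -> shift_coef n = 0.
Proof.
case: n => [//|n] nq /=.
rewrite cyclic_coef_small ?size_XB1n 1?ltnW //.
by rewrite nth_default // size_XB1n; lia.
Qed.

Lemma shift_coef_period : shift_coef q = 1.
Proof.
rewrite -(prednK q_gt0) /= cyclic_coef_small ?size_XB1n ?prednK //.
have : ('X - 1 : {poly R}) ^+ q.-1 \is monic.
  by rewrite monic_exp // -polyC1 monicXsubC.
by rewrite monicE lead_coefE size_XB1n => /eqP.
Qed.

End CyclicCoef.

Lemma shift_coef_dvd (R : comNzRingType) (p k e n : nat) : prime p -> (0 < k)%N ->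
  (p ^ k.-1 + e * (p ^ k.-1 * p.-1) < n)%N ->
  exists c, shift_coef R (p ^ k) n = p%:R ^+ e * c.
Proof.
move=> hp k_gt0; case: n => // n; rewrite ltnS => le_n /=.
have q_gt0 : (0 < p ^ k)%N by rewrite expn_gt0 prime_gt0.
have [u [v [w E]]] := weisman_congruence k.-1 e ('X : {poly R}) hp.
rewrite prednK // in E.
rewrite -(subnK le_n) exprD E mulrDr [X in _ + X]mulrA cyclic_coef_add_mull //.
by rewrite mulrCA -natrX cyclic_coef_natrM // natrX; eexists.
Qed.

(** Writing d = trunc_log p n - k, the left-hand side is
    p ^ k.-1 * (1 + d.+1 * p.-1), and Bernoulli's inequality bounds the second
    factor by p ^ d.+1, so the total by p ^ trunc_log p n <= n.  Strictness
    comes from p ^ k < n if d = 0, and from Bernoulli's inequality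
    if d > 0. *)
Lemma weisman_exponent_lt p k n : prime p -> (0 < k)%N -> (p ^ k < n)%N ->
  (p ^ k.-1 + (trunc_log p n - k).+1 * (p ^ k.-1 * p.-1) < n)%N.
Proof.
move=> hp k_gt0 lt_n; have p_gt1 := prime_gt1 hp.
have n_gt0 : (0 < n)%N by exact: leq_ltn_trans lt_n.
have /andP[le_n _] := trunc_log_bounds p_gt1 n_gt0.
have le_k : (k <= trunc_log p n)%N by rewrite trunc_log_max // ltnW.
move: le_n le_k; set l := trunc_log p n => le_n le_k.
have -> d : (p ^ k.-1 + d * (p ^ k.-1 * p.-1) = p ^ k.-1 * (1 + d * p.-1))%N by lia.
(* Bernoulli's inequality for exponent d.+1, which is strict unless d = 0. *)
have bern d : (1 + d.+1 * p.-1 + (0 < d) <= p ^ d.+1)%N.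
  elim: d => [|d IHd]; first by rewrite expn1; lia.
  rewrite expnS; nia.
case: (posnP (l - k)%N) => [l0|d_gt0].
  rewrite l0 mul1n add1n prednK -?expnSr ?prednK //; lia.
have El : l = (k.-1 + (l - k).+1)%N by lia.
apply: leq_trans le_n; rewrite [X in (_ < p ^ X)%N]El expnD.
rewrite ltn_pmul2l ?expn_gt0 ?prime_gt0 //.
by have := bern (l - k)%N; rewrite d_gt0 addn1.
Qed.

(** * The p-adic shift and its Mahler expansion *)

Section Padic.
Variables (p : nat) (hp : prime p).
Local Notation Zp := (padic_int hp).

Lemma padic_shift_nat m : padic_shift (m%:R : Zp) = (m %/ p)%:R.
Proof.
rewrite -[RHS]padic_digitK; apply: padic_ext => n /=.
congr (_ %% _)%N; apply: eq_bigr => i _; congr (_ * _)%N.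
by rewrite /padic_digit !padic_res_nat modn_divl -divnMA -expnSr -expnS.
Qed.

Lemma iter_padic_shift_nat k m : iter k (@padic_shift p hp) m%:R = (m %/ p ^ k)%:R.
Proof.
elim: k => [|k IHk]; first by rewrite divn1.
by rewrite iterS IHk padic_shift_nat expnSr divnMA.
Qed.

(** At a natural number m the series stops at n = m, because 'C(m, n) = 0 beyond,
    so its limit is its constant value. *)
Lemma mahler_expansion_nat (T : Zp -> Zp) (a : nat -> Zp) m :
  mahler_expansion T a -> T m%:R = \sum_(n < m.+1) a n * 'C(m, n)%:R.
Proof.
move=> /(_ m%:R) cvgT; apply: (cvg_unique _ cvgT); first exact: metric_hausdorff.
apply: cvg_near_cst; exists m.+1 => // N /= lt_mN.
rewrite /series /= (big_cat_nat (leq0n _) lt_mN) /= big_mkord.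
rewrite [X in _ + X]big_nat_cond [X in _ + X]big1 ?addr0.
  by apply: eq_bigr => i _; rewrite padic_binom_nat.
by move=> i /andP[/andP[lt_mi _] _]; rewrite padic_binom_nat bin_small ?mulr0.
Qed.

(** The system is triangular with diagonal entries 'C(m, m) = 1. *)
Lemma bin_sum_inj (a b : nat -> Zp) :
  (forall m, \sum_(n < m.+1) a n * 'C(m, n)%:R = \sum_(n < m.+1) b n * 'C(m, n)%:R) ->
  a =1 b.
Proof.
move=> eq_ab m; elim/ltn_ind: m => m IHm.
have := eq_ab m; rewrite !big_ord_recr /= binn !mulr1.
by under eq_bigr do rewrite IHm //; move/addrI.
Qed.

Lemma padic_abs_dvd e (c : Zp) : padic_abs (p%:R ^+ e * c) <= p%:R ^- e.
Proof.
by rewrite padic_abs_le padic_resM -natrX padic_res_nat modnn mul0n mod0n.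
Qed.

Lemma padic_abs1 : padic_abs (1 : Zp) = 1.
Proof.
apply/eqP; rewrite eq_le; apply/andP; split.
  by have := padic_abs_le (1 : Zp) 0; rewrite expr0 invr1 padic_res_ord0.
case: (padic_abs_cases (1 : Zp)) => [/padic_abs_eq0/eqP|[e E]].
  by rewrite oner_eq0.
have := padic_abs_le (1 : Zp) e; rewrite E lexx => /esym.
case: e E => [|e] E; first by rewrite expr0 invr1.
have := padic_res_nat hp 1 e.+1; rewrite mulr1n => ->.
by rewrite modn_small // -(exp1n e.+1) ltn_exp2r // prime_gt1.
Qed.

End Padic.

Theorem corollary3p3 (p : nat) (hp : prime p) (k : nat) (hk : (1 <= k)%N)
    (a : nat -> padic_int hp)
    (ha : mahler_expansion (iter k (@padic_shift p hp)) a) :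
  [/\ forall n : nat, (1 <= n)%N ->
        (p ^ trunc_log p n)%:R * padic_abs (a n) <= (p ^ k)%:R :> rat,
      (p ^ trunc_log p (p ^ k))%:R * padic_abs (a (p ^ k)%N) = (p ^ k)%:R :> rat
    & forall n : nat, (1 <= n)%N ->
        (p ^ trunc_log p n)%:R * padic_abs (a n) = (p ^ k)%:R :> rat ->
        n = (p ^ k)%N].
Proof.
have p_gt1 := prime_gt1 hp.
have q_gt0 : (0 < p ^ k)%N by rewrite expn_gt0 prime_gt0.
have p_gt0 : 0 < p%:R :> rat by rewrite ltr0n prime_gt0.
have aE : a =1 shift_coef (padic_int hp) (p ^ k).
  apply: bin_sum_inj => m; rewrite -(mahler_expansion_nat _ ha).
  by rewrite iter_padic_shift_nat sum_shift_coef.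
have at_q : (p ^ trunc_log p (p ^ k))%:R * padic_abs (a (p ^ k)%N) = (p ^ k)%:R :> rat.
  by rewrite aE shift_coef_period // padic_abs1 mulr1 trunc_expnK.
have off_q n : (1 <= n)%N -> n != (p ^ k)%N ->
    (p ^ trunc_log p n)%:R * padic_abs (a n) < (p ^ k)%:R :> rat.
  move=> n_gt0; rewrite neq_ltn => /orP[lt_nq|lt_qn].
    by rewrite aE shift_coef_small // padic_abs0 mulr0 ltr0n.
  have [c Ec] := shift_coef_dvd (padic_int hp) hp hk
    (weisman_exponent_lt hp hk lt_qn).
  have le_k : (k <= trunc_log p n)%N by rewrite trunc_log_max // ltnW.
  apply: (@le_lt_trans _ _ ((p ^ trunc_log p n)%:R * p%:R ^- (trunc_log p n - k).+1)).
    by rewrite ler_wpM2l ?ler0n // aE Ec padic_abs_dvd.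
  rewrite ltr_pdivrMr ?exprn_gt0 // -natrX -natrM -expnD ltr_nat ltn_exp2l //.
  by rewrite addnS subnKC.
split => //.
  move=> n n_gt0; have [->|/(off_q n n_gt0)/ltW//] := eqVneq n (p ^ k)%N.
  by rewrite at_q.
move=> n n_gt0 eq_n; apply/eqP; apply: contraT => /(off_q n n_gt0).
by rewrite eq_n ltxx.
Qed.
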